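(* Let $G$ be a torsion-free abelian group. If $ns(G)=0$, then $p^\omega G=0$ for every prime $p$.
   Context: $\mathbb N=\{0,1,2,\dots\}$ and $\mathbb N_+=\mathbb N\setminus\{0\}$. Let $\phi$ be an endomorphism of an abelian group $G$. A string of $\phi$ is a sequence $S=\{x_n\}_{n\in\mathbb N}$ of pairwise distinct elements of $G$ such that $\phi(x_n)=x_{n-1}$ for every $n\in\mathbb N_+$. A string is singular if $\phi^j(x_0)=\phi^k(x_0)$ for some $j\neq k$ in $\mathbb N$, and non-singular otherwise. Define $ns(\phi)$ as the supremum of the cardinalities $|\mathcal F|$, where $\mathcal F$ ranges over the families of pairwise disjoint non-singular strings of $\phi$; if this supremum is infinite it is set equal to the symbol $\infty$. For an abelian group $G$, $ns(G)=\sup\{ns(\phi):\phi\in\mathrm{End}(G)\}$. For a prime $p$, $p^\omega G=\bigcap_{n\in\mathbb N}p^nG$. *)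

(* Defs.v *)
From HB Require Import structures.
From mathcomp Require Import all_boot all_order all_algebra finmap.
From mathcomp Require Import boolp classical_sets functions cardinality.
From mathcomp Require Import constructive_ereal.

Set Implicit Arguments.
Unset Strict Implicit.
Unset Printing Implicit Defensive.

Import Order.TTheory GRing.Theory Num.Theory.
Local Open Scope classical_set_scope.
Local Open Scope ring_scope.

(* All values lie in N together with +oo, viewed inside [\bar int]; every
   infinite cardinality is identified with +oo. *)
Definition ecard (T : choiceType) (A : set T) : \bar int :=
  if `[< finite_set A >] then (#|` fset_set A|%:Z)%:E else +oo%E.

(* [supremum] is a total function returning its default 0 when there is no least
   upper bound; [ns_endo_supremums] and [ns_supremums] below show that this
   never happens in the definitions of [ns_endo] and [ns]. *)
Definition esup (A : set (\bar int)) : \bar int := supremum 0%E A.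

Section Strings.
Variables (G : zmodType) (phi : {additive G -> G}).

Definition is_string (x : nat -> G) : Prop :=
  injective x /\ forall n, (0 < n)%N -> phi (x n) = x n.-1.

Definition singular (x : nat -> G) : Prop :=
  exists j k : nat, j <> k /\ iter j phi (x 0%N) = iter k phi (x 0%N).

Definition ns_string (x : nat -> G) : Prop := is_string x /\ ~ singular x.

Definition ns_family (F : set (nat -> G)) : Prop :=
  (forall x, F x -> ns_string x) /\ trivIset F (fun x => range x).

Definition ns_endo : \bar int := esup [set ecard F | F in ns_family].

End Strings.

Definition ns (G : zmodType) : \bar int :=
  esup [set ns_endo phi | phi in [set: {additive G -> G}]].

Definition torsion_free (G : zmodType) : Prop :=
  forall (x : G) (n : nat), (0 < n)%N -> x *+ n = 0 -> x = 0.

Definition p_omega (p : nat) (G : zmodType) : set G :=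
  \bigcap_(n in [set: nat]) [set x *+ (p ^ n)%N | x in [set: G]].
Arguments p_omega p%_N G : clear implicits.

Definition enat_valued (A : set (\bar int)) : Prop :=
  forall x, A x -> x = +oo%E \/ exists n : nat, x = n%:Z%:E.

Lemma esupP (A : set (\bar int)) :
  A !=set0 -> enat_valued A -> supremums A (esup A).
Proof.
move=> A0 AN; have [a Aa] := A0.
have ubN y : ubound A y -> y = +oo%E \/ exists n : nat, y = n%:Z%:E.
  move=> /(_ _ Aa); case: (AN _ Aa) => [->|[n ->]].
    by rewrite leye_eq => /eqP ->; left.
  case: y => [[m|m]| |]; [by right; exists m| |by left|by rewrite leeNy_eq].
  by rewrite lee_fin.
suff [s As] : supremums A !=set0.
  rewrite /esup /supremum; case: eqP => [AE|_]; first by rewrite AE in Aa.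
  by case: xgetP => [y -> //|/(_ s)].
have [[n nA]|noub] := pselect (exists n : nat, ubound A n%:Z%:E); last first.
  exists +oo%E; split=> [x _|y yA]; first exact: leey.
  by case: (ubN _ yA) => [-> //|[n yn]]; case: noub; exists n; rewrite -yn.
have exn : exists n, `[< ubound A n%:Z%:E >] by exists n; apply/asboolP.
case: (ex_minnP exn) => m /asboolP mA mmin.
exists m%:Z%:E; split=> // y yA.
case: (ubN _ yA) => [->|[k yk]]; first exact: leey.
by rewrite yk lee_fin lez_nat mmin //; apply/asboolP; rewrite -yk.
Qed.

Lemma esup_enat (A : set (\bar int)) :
  A !=set0 -> enat_valued A -> esup A = +oo%E \/ exists n : nat, esup A = n%:Z%:E.
Proof.
move=> A0 AN; have [ubA _] := esupP A0 AN; have [a Aa] := A0.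
have := ubA _ Aa; case: (AN _ Aa) => [->|[n ->]].
  by rewrite leye_eq => /eqP ->; left.
case: (esup A) => [[m|m]| |]; [by right; exists m| |by left|by rewrite leeNy_eq].
by rewrite lee_fin.
Qed.

Section Wf.
Variable G : zmodType.

Lemma ns_endo_image0 (phi : {additive G -> G}) :
  [set ecard F | F in ns_family phi] !=set0.
Proof. by exists (ecard (set0 : set (nat -> G))), set0; split=> // i j []. Qed.

Lemma ns_endo_image_enat (phi : {additive G -> G}) :
  enat_valued [set ecard F | F in ns_family phi].
Proof.
move=> _ [F _ <-]; rewrite /ecard; case: ifP => _; last by left.
by right; eexists.
Qed.

Lemma ns_endo_supremums (phi : {additive G -> G}) :
  supremums [set ecard F | F in ns_family phi] (ns_endo phi).
Proof. exact: esupP (ns_endo_image0 phi) (@ns_endo_image_enat phi). Qed.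

Lemma ns_supremums :
  supremums [set ns_endo phi | phi in [set: {additive G -> G}]] (ns G).
Proof.
apply: esupP; first by exists (ns_endo (idfun : {additive G -> G})), idfun.
by move=> _ [phi _ <-]; apply: esup_enat;
  [exact: ns_endo_image0|exact: ns_endo_image_enat].
Qed.

End Wf.

(* Main.v *)
Require Import Defs.
From mathcomp Require Import all_boot all_order all_algebra.
From mathcomp Require Import boolp classical_sets constructive_ereal.
From HB Require Import structures.
From mathcomp Require Import finmap cardinality.

(** Multiplication by [p] is an endomorphism of [G]. A nonzero [x] in
    $p^\omega G$ has a [p^n]-th part [y n] for every [n]; division being unique
    in a torsion-free group, these parts satisfy [y n.+1 *+ p = y n] and so form
    a backward orbit of [x] under that endomorphism. A coincidence within this
    orbit, or within the forward orbit of [x], would equate two different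
    multiples of a nonzero element, which torsion-freeness forbids
    ([mulrIn_torsion_free]). Hence [y] is a non-singular string, and a single
    such string already gives [1 <= ns G] ([ns_string_ns_ge1]). *)

Import Order.TTheory GRing.Theory Num.Theory.
Local Open Scope classical_set_scope.
Local Open Scope ring_scope.

Section MultiplicationEndomorphism.
Variables (G : zmodType) (m : nat).

Definition mulrn_endo (x : G) : G := x *+ m.

Fact mulrn_endo_is_zmod_morphism : zmod_morphism mulrn_endo.
Proof. by move=> x y; rewrite /mulrn_endo mulrnBl. Qed.

HB.instance Definition _ :=
  GRing.isZmodMorphism.Build G G mulrn_endo mulrn_endo_is_zmod_morphism.

Lemma iter_mulrn_endo (k : nat) (x : G) : iter k mulrn_endo x = x *+ (m ^ k)%N.
Proof. by elim: k => [//|k IH]; rewrite iterS IH /mulrn_endo -mulrnA -expnSr. Qed.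

End MultiplicationEndomorphism.

(** The family consisting of the given string alone is already a competitor in
    the supremum [ns_endo phi]. *)
Lemma ns_string_ns_ge1 {G : zmodType} (phi : {additive G -> G}) (x : nat -> G) :
  ns_string phi x -> (1%:E <= ns G)%E.
Proof.
move=> xP; have [ub_ns _] := ns_supremums G.
have [ub_phi _] := ns_endo_supremums phi.
apply: le_trans (ub_ns _ (imageP _ I)).
apply: ub_phi; exists [set x].
  by split=> [_ -> //|_ _ -> ->].
rewrite /ecard asboolT; last exact: finite_set1.
by rewrite fset_set1 cardfs1.
Qed.

Lemma mulrnI_torsion_free {G : zmodType} (m : nat) :
  torsion_free G -> (0 < m)%N -> injective (fun x : G => x *+ m).
Proof.
move=> tfG m_gt0 x y /eqP; rewrite -subr_eq0 -mulrnBl => /eqP /tfG.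
by move=> /(_ m_gt0) /eqP; rewrite subr_eq0 => /eqP.
Qed.

Lemma mulrIn_torsion_free {G : zmodType} (x : G) :
  torsion_free G -> x <> 0 -> injective (fun m => x *+ m).
Proof.
move=> tfG x_neq0.
have mulr_inj_le a b : (a <= b)%N -> x *+ a = x *+ b -> a = b.
  move=> le_ab xab; apply/eqP; rewrite eqn_leq le_ab leqNgt /=.
  apply/negP => lt_ab; apply/x_neq0/(tfG x (b - a)%N); first by rewrite subn_gt0.
  by rewrite mulrnBr // xab subrr.
move=> a b; have [le_ab|/ltnW le_ba] := leqP a b; first exact: mulr_inj_le.
by move=> /esym /mulr_inj_le ->.
Qed.

(** Every condition on the string reduces to an equality between two multiples
    by powers of [m]: cancelling [m ^ n] gives the backward-orbit relation, and
    both kinds of coincidence contradict the injectivity of [n |-> m ^ n],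
    which holds as [1 < m]. *)
Lemma ns_string_quotients {G : zmodType} (m : nat) (x : G) (y : nat -> G) :
  torsion_free G -> (1 < m)%N -> x <> 0 ->
  (forall n, y n *+ (m ^ n)%N = x) ->
  ns_string (mulrn_endo G m) y.
Proof.
move=> tfG m_gt1 x_neq0 yP; have m_gt0 := ltnW m_gt1.
have y0 : y 0%N = x by rewrite -(yP 0%N).
split; first split.
- move=> i j yij; apply: (expnI m_gt1).
  (* A vanishing quotient would make its multiple [x] vanish too. *)
  have yi_neq0 : y i <> 0 by move=> yi0; apply: x_neq0; rewrite -(yP i) yi0 mul0rn.
  by apply: (mulrIn_torsion_free _ tfG yi_neq0); rewrite yP yij yP.
- case=> [//|n] _; rewrite /= /mulrn_endo.
  apply: (@mulrnI_torsion_free _ (m ^ n)%N tfG); first by rewrite expn_gt0 m_gt0.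
  by rewrite -mulrnA -expnS !yP.
- move=> [j [k [jk]]]; rewrite !iter_mulrn_endo y0.
  by move=> /(mulrIn_torsion_free _ tfG x_neq0) /(expnI m_gt1).
Qed.

Theorem proposition4p3 (G : zmodType) :
  torsion_free G -> ns G = 0%E ->
  forall p : nat, prime p -> p_omega p G = [set 0].
Proof.
move=> tfG nsG0 p p_prime; apply/seteqP; split=> [x xP|_ -> n _]; last first.
  by exists 0; rewrite ?mul0rn.
apply: contrapT => x_neq0.
have /choice[y yP] : forall n, exists z : G, z *+ (p ^ n)%N = x.
  by move=> n; have [z _ zP] := xP n I; exists z.
have := ns_string_ns_ge1 _ _
  (ns_string_quotients _ _ _ tfG (prime_gt1 p_prime) x_neq0 yP).
by rewrite nsG0.
Qed.
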